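(* Let $(X,T)$ be a Polish dynamical system. If $\mu\in\mathcal{M}_T(X)$, then the set $G_\mu$ of $\mu$-generic points is a $\boldsymbol{\Pi}^0_3$ set.
   Context: A Polish dynamical system $(X,T)$ is a Polish space $X$ with a continuous map $T\colon X\to X$. $\mathcal{M}_T(X)$ is the set of $T$-invariant Borel probability measures on $X$. $G_\mu$ is the set of $x\in X$ such that $\frac1n\sum_{j=0}^{n-1}\delta_{T^j(x)}\to\mu$ as $n\to\infty$ in the weak$^*$ topology (convergence of integrals of all bounded continuous real functions on $X$). $\boldsymbol{\Pi}^0_3$ sets are the countable intersections of $F_\sigma$ sets. *)

(* Defs.v *)
From HB Require Import structures.
From mathcomp Require Import all_boot all_order all_algebra.
From mathcomp Require Import all_classical all_reals all_analysis.
From mathcomp Require Import borel_hierarchy.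

Set Implicit Arguments.
Unset Strict Implicit.
Unset Printing Implicit Defensive.

Import Order.TTheory GRing.Theory Num.Theory.
Import numFieldNormedType.Exports.

Local Open Scope classical_set_scope.
Local Open Scope ring_scope.

Definition is_metric (R : realType) (X : Type) (d : X -> X -> R) : Prop :=
  [/\ forall x y, 0 <= d x y,
      forall x y, d x y = 0 <-> x = y,
      forall x y, d x y = d y x &
      forall x y z, d x z <= d x y + d y z].

Definition metric_compatible (R : realType) (X : topologicalType)
    (d : X -> X -> R) : Prop :=
  forall A : set X, open A <->
    (forall x, A x -> exists2 e : R, 0 < e & [set y | d x y < e] `<=` A).

Definition metric_cauchy (R : realType) (X : Type) (d : X -> X -> R)
    (u : nat -> X) : Prop :=
  forall e : R, 0 < e ->
    exists N : nat, forall m n, (N <= m)%N -> (N <= n)%N -> d (u m) (u n) < e.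

Definition metric_complete (R : realType) (X : Type) (d : X -> X -> R) : Prop :=
  forall u : nat -> X, metric_cauchy d u ->
    exists l : X, (fun n => d (u n) l) @ \oo --> (0 : R).

Definition separable_space (X : topologicalType) : Prop :=
  exists2 D : set X, countable D & dense D.

Definition polish_space (R : realType) (X : topologicalType) : Prop :=
  separable_space X /\
  exists d : X -> X -> R,
    [/\ is_metric d, metric_compatible d & metric_complete d].

(* X is pointed because the library requires it of a measurable type; this
   excludes only the empty space, which carries no probability measure. *)
Notation borel X := (g_sigma_algebraType (@open X)).

Definition invariant_measures (R : realType) (X : ptopologicalType)
    (T : X -> X) : set (probability (borel X) R) :=
  [set mu : probability (borel X) R |
    forall A : set (borel X), measurable A -> mu (T @^-1` A) = mu A].

(* At n = 0 this is the zero measure, as 0^-1 = 0. *)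
Definition empirical_measure (R : realType) (X : ptopologicalType)
    (T : X -> X) (x : X) (n : nat) : {measure set (borel X) -> \bar R} :=
  mscale (n%:R^-1 : R)%:nng
    (msum (fun j => \d_(iter j T x : borel X)) n).

Definition weak_cvg (R : realType) (X : ptopologicalType)
    (nu : nat -> {measure set (borel X) -> \bar R})
    (mu : {measure set (borel X) -> \bar R}) : Prop :=
  forall f : X -> R, continuous f -> bounded_fun f ->
    (fun n => \int[nu n]_x f x) @ \oo --> \int[mu]_x f x.

Definition generic_points (R : realType) (X : ptopologicalType) (T : X -> X)
    (mu : probability (borel X) R) : set X :=
  [set x | weak_cvg (empirical_measure R T x) mu].

Definition Pi03 (X : topologicalType) (S : set X) : Prop :=
  exists2 F : (set X)^nat, (forall i, Fsigma (F i)) & S = \bigcap_i F i.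

(* Main.v *)
(** Only countably many test functions are needed. For [a] in a countable dense
    set, [q] rational and [m] natural, consider the bump
    [y |-> max 0 (q - m d(a, y))]. Every continuous [f >= 0] is the increasing
    limit of finite maxima of those bumps that lie below [f]. If the Birkhoff
    averages at [x] converge to the [mu]-integral for every finite maximum of
    bumps, then monotone convergence gives [liminf A_n f x >= mu(f)] for every
    bounded continuous [f >= 0]; applied to [c + f] and [c - f], this yields
    convergence for every bounded continuous [f]. So the set of generic points
    is a countable intersection of sets [{x | A_n g x --> mu(g)}] with [A_n g]
    continuous, each of which is Pi03. *)
Require Import Defs.
From mathcomp Require Import all_boot all_order all_algebra.
From mathcomp Require Import all_classical all_reals all_analysis.
From mathcomp Require Import borel_hierarchy measurable_realfun lra.

Set Implicit Arguments.
Unset Strict Implicit.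
Unset Printing Implicit Defensive.

Import Order.TTheory GRing.Theory Num.Theory.
Import numFieldNormedType.Exports.

Local Open Scope classical_set_scope.
Local Open Scope ring_scope.

(** * Countable intersections and convergence sets in the Borel hierarchy *)

Section Pi03.
Context {X : topologicalType}.

(** Coding pairs [(i, j)] by one natural number turns the double intersection into a single one;
    numbers that code no pair contribute [setT], which is closed. *)
Lemma bigcap_Pi03 (F : (set X)^nat) :
  (forall i, Pi03 (F i)) -> Pi03 (\bigcap_i F i).
Proof.
move=> /(_ _)/cid2-/all_sig2[G GF FE].
exists (fun n => if @unpickle (nat * nat)%type n is Some (i, j)
                 then G i j else setT).
  move=> n; case: unpickle => [[i j]|]; first exact: GF.
  exact/closed_Fsigma/closedT.
apply/seteqP; split=> x Fx n _; last first.
  rewrite FE => j _.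
  by have := Fx (pickle (n, j)) I; rewrite pickleK.
case: unpickle => [[i j]|//].
by have := Fx i I; rewrite FE; apply.
Qed.

(** For every [k], some [N] bounds all later errors by [1 / (k + 1)]; the non-strict bound makes the
    inner intersections closed. *)
Lemma cvg_Pi03 (R : realType) (a : nat -> X -> R) (c : R) :
  (forall n, continuous (a n)) -> Pi03 [set x | a ^~ x @ \oo --> c].
Proof.
move=> ca.
exists (fun k => \bigcup_N \bigcap_(n in [set n | (N <= n)%N])
   [set x | `|c - a n x| <= k.+1%:R^-1]).
  move=> k; eexists; last reflexivity.
  move=> N; apply: closed_bigI => n _.
  have -> : [set x | `|c - a n x| <= k.+1%:R^-1] =
    (fun x => `|c - a n x|) @^-1` [set y | y <= k.+1%:R^-1] by [].
  apply: preimage_closed; last exact: closed_le.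
  move=> x _; apply: cvg_norm; apply: cvgB; [exact: cvg_cst|exact: ca].
apply/seteqP; split=> x /=.
  move/cvgrPdist_le => ac k _.
  have [|N _ Nk] := ac k.+1%:R^-1; first by rewrite invr_gt0.
  by exists N => // n /Nk.
move=> H; apply/cvgrPdist_le => e e0.
have [k _ ke] := near_infty_natSinv_lt (PosNum e0).
have [N _ Nk] := H k I.
exists N => // n /Nk /= /le_trans; apply; apply/ltW.
exact: (ke k (leqnn k)).
Qed.

End Pi03.

Lemma bounded_funP (R : realType) (X : Type) (f : X -> R) :
  bounded_fun f <-> exists c : R, forall y, `|f y| <= c.
Proof.
split=> [[M [_ fM]]|[c fc]]; first exists (`|M| + 1) => y.
  by apply: fM => //; rewrite (le_lt_trans (ler_norm _))// ltrDl.
by exists c; split=> [|r cr y _]; [exact: num_real|exact: le_trans (ltW cr)].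
Qed.

(** * Measurability and integrability of continuous functions *)

Section borel_functions.
Context (R : realType) (X : ptopologicalType).
Implicit Types f : X -> R.

Lemma continuous_borel_measurable f :
  continuous f -> measurable_fun (setT : set (borel X)) f.
Proof.
move=> /continuousP cf; apply: (measurability _ (RGenOpens.measurableE R)).
move=> _ [_ [a [b ->] <-]]; rewrite setTI.
by apply: sub_sigma_algebra; apply: cf; exact: interval_open.
Qed.

Lemma continuous_bounded_integrable
    (m : {measure set (borel X) -> \bar R}) f : (m setT < +oo)%E ->
  continuous f -> bounded_fun f -> m.-integrable setT (EFin \o f).
Proof.
by move=> mT cf bf; apply: measurable_bounded_integrable => //;
  exact: continuous_borel_measurable.
Qed.

End borel_functions.

(** * Birkhoff averages as integrals against empirical measures *)

Section birkhoff_average.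
Context (R : realType) (X : ptopologicalType) (T : X -> X).
Implicit Types (f g : X -> R) (x : X) (n : nat).

Definition birkhoff_average f n x : R :=
  n%:R^-1 * \sum_(j < n) f (iter j T x).

Lemma birkhoff_average_continuous f n :
  continuous T -> continuous f -> continuous (birkhoff_average f n).
Proof.
move=> cT cf x; apply: cvgM; first exact: cvg_cst.
apply: (cvg_big (@add_continuous R^o)) => j _.
have cTj : {for x, continuous (iter j T)}.
  elim: (j : nat) => [|k IH]; first exact: cvg_id.
  exact: (continuous_comp IH (cT _)).
exact: (continuous_comp cTj (cf _)).
Qed.

Lemma birkhoff_averageB f g n x :
  birkhoff_average (fun y => f y - g y) n x =
  birkhoff_average f n x - birkhoff_average g n x.
Proof. by rewrite /birkhoff_average sumrB mulrBr. Qed.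

Lemma birkhoff_averageD f g n x :
  birkhoff_average (fun y => f y + g y) n x =
  birkhoff_average f n x + birkhoff_average g n x.
Proof. by rewrite /birkhoff_average big_split mulrDr. Qed.

Lemma birkhoff_average_cst c n x : (0 < n)%N ->
  birkhoff_average (fun=> c) n x = c.
Proof.
move=> n0; rewrite /birkhoff_average sumr_const card_ord -[c *+ n]mulr_natl.
by rewrite mulrA mulVf ?mul1r// pnatr_eq0 -lt0n.
Qed.

Lemma le_birkhoff_average f g n x : (forall y, f y <= g y) ->
  birkhoff_average f n x <= birkhoff_average g n x.
Proof. by move=> fg; rewrite ler_wpM2l ?invr_ge0// ler_sum. Qed.

Lemma empirical_measure_setT_fin x n :
  (empirical_measure R T x n setT < +oo)%E.
Proof.
rewrite /empirical_measure/= /mscale/= /msum/=.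
under eq_bigr do rewrite diracT.
by rewrite sumEFin -EFinM ltry.
Qed.

Lemma ge0_Rintegral_empirical f n x :
  continuous f -> (forall y, 0 <= f y) ->
  \int[empirical_measure R T x n]_y f y = birkhoff_average f n x.
Proof.
move=> cf f0.
have mf : measurable_fun (setT : set (borel X)) (EFin \o f).
  by apply/measurable_EFinP; exact: continuous_borel_measurable.
rewrite /Rintegral /empirical_measure ge0_integral_mscale//; last first.
  by move=> y _; rewrite lee_fin.
rewrite ge0_integral_measure_sum//; last by move=> y _; rewrite lee_fin.
under eq_bigr do rewrite integral_dirac// diracT mul1e.
by rewrite sumEFin.
Qed.

(** A bound [c] of [|f|] makes [f + c] nonnegative, so writing [f = (f + c) - c] reduces this to the
    nonnegative case. *)
Lemma Rintegral_empirical f n x : continuous f -> bounded_fun f ->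
  \int[empirical_measure R T x n]_y f y = birkhoff_average f n x.
Proof.
move=> cf bf; have [c fc] := (bounded_funP _).1 bf.
have c0 : 0 <= c by exact: le_trans (fc point).
have cc : continuous (fun _ : X => c) by move=> y; exact: cvg_cst.
have bc : bounded_fun (fun _ : X => c) by apply/bounded_funP; exists `|c|.
have -> : f = (fun y => (f y + c) - c) by apply/funext => y; rewrite addrK.
have cD : continuous (fun y => f y + c).
  by move=> y; apply: cvgD; [exact: cf|exact: cvg_cst].
have bD : bounded_fun (fun y => f y + c) by exact: bounded_funD.
rewrite RintegralB//; try apply: continuous_bounded_integrable => //;
  try exact: empirical_measure_setT_fin.
rewrite !ge0_Rintegral_empirical ?birkhoff_averageB// => y.
rewrite -[X in X <= _](addNr c) lerD2r.
by have := fc y; rewrite ler_norml => /andP[].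
Qed.

End birkhoff_average.

(** * Bump functions on a separable metric space *)

Section metric_bumps.
Context (R : realType) (X : topologicalType) (d : X -> X -> R).
Hypotheses (md : is_metric d) (cd : metric_compatible d).

Lemma metric_ball_open x (e : R) : open [set y | d x y < e].
Proof.
case: md => _ _ _ tri; apply/cd => y /= xy; exists (e - d x y).
  by rewrite subr_gt0.
by move=> z /= yz; apply: le_lt_trans (tri x y z) _; lra.
Qed.

Lemma metric_ball_center x (e : R) : 0 < e -> d x x < e.
Proof. by case: md => _ d0 _ _; rewrite (d0 x x).2. Qed.

(** By the triangle inequality, [d a] is 1-Lipschitz. *)
Lemma metric_continuous a : continuous (d a).
Proof.
case: md => _ _ sym tri x; apply/cvgrPdist_lt => e e0.
have := metric_ball_open x e; rewrite openE => /(_ x (metric_ball_center x e0)).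
apply: filterS => y /= xy.
have := tri a x y; have := tri a y x; rewrite (sym y x) ltr_norml; lra.
Qed.

Variable a : nat -> X.
Hypothesis dense_a : forall x (e : R), 0 < e -> exists i, d x (a i) < e.

(* [i] encodes a center [a k], a rational height [q] and a slope [m]. *)
Definition bump (i : nat) (y : X) : R :=
  if @unpickle (nat * rat * nat)%type i is Some (k, q, m)
  then Num.max 0 (ratr q - m%:R * d (a k) y) else 0.

(** Indexing by lists of codes keeps the family countable; the base value [0] is harmless because
    bumps are nonnegative. *)
Definition bump_max (s : seq nat) (y : X) : R :=
  \big[Num.max/0]_(i <- s) bump i y.

Lemma bump_continuous i : continuous (bump i).
Proof.
rewrite /bump; case: unpickle => [[[k q] m]|] x; last exact: cvg_cst.
apply: (@continuous_max R X (fun=> 0) (fun y => ratr q - m%:R * d (a k) y));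
  first exact: cvg_cst.
apply: cvgB; first exact: cvg_cst.
by apply: cvgM; [exact: cvg_cst|exact: metric_continuous].
Qed.

Lemma bump_le i : exists c, forall y, bump i y <= c.
Proof.
rewrite /bump; case: unpickle => [[[k q] m]|]; last by exists 0.
exists (Num.max 0 (ratr q)) => y; rewrite ge_max !le_max lexx/=.
by case: md => d0 _ _ _; rewrite gerBl mulr_ge0 ?orbT.
Qed.

Lemma bump_max_ge0 s y : 0 <= bump_max s y.
Proof. by rewrite /bump_max bigmax_ge_id. Qed.

Lemma bump_max_continuous s : continuous (bump_max s).
Proof.
rewrite /bump_max; elim: s => [|i s IH] x.
  by under eq_fun do rewrite big_nil; exact: cvg_cst.
under eq_fun do rewrite big_cons.
by apply: (@continuous_max R X (bump i));
  [exact: bump_continuous|exact: IH].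
Qed.

Lemma bump_max_bounded s : bounded_fun (bump_max s).
Proof.
apply/bounded_funP; suff [c bc] : exists c, forall y, bump_max s y <= c.
  by exists c => y; rewrite ger0_norm ?bump_max_ge0.
rewrite /bump_max; elim: s => [|i s [c IH]].
  by exists 0 => y; rewrite big_nil.
have [c' bc'] := bump_le i; exists (Num.max c' c) => y.
by rewrite big_cons ge_max !le_max bc' IH orbT.
Qed.

(** The height [q] is just below [f x], the centre is near [x], and the slope is so steep that the
    bump vanishes before [f] can drop to [q]. *)
Lemma bump_sup (f : X -> R) x (e : R) :
  continuous f -> (forall y, 0 <= f y) -> 0 < e ->
  exists i, (forall y, bump i y <= f y) /\ f x - e < bump i x.
Proof.
move=> cf f0 e0; have [d0 _ sym tri] := md.
have [q] := @rat_in_itvoo R (f x - e) (f x) ltac:(lra).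
rewrite in_itv/= => /andP[q1 q2].
have : open (f @^-1` [set r | ratr q < r]).
  by move: cf => /continuousP; apply; exact: open_gt.
move=> /cd/(_ x q2)[r r0 rf].
(* This slope brings the bump to zero at distance [r / 2] from its centre. The absolute value covers
   negative [q], and the successor keeps [m] positive. *)
have [m m0 mq] : exists2 m : nat, 0 < m%:R :> R & ratr q < m%:R * (r / 2).
  exists (Num.truncn (2 * `|ratr q : R| / r)).+1 => //.
  have := truncnS_gt (2 * `|ratr q : R| / r); rewrite ltr_pdivrMr//.
  have := ler_norm (ratr q : R); lra.
(* The first bound makes the bump vanish outside the ball of radius [r] about [x]; the second keeps
   the loss [m * d (a k) x] below [q - (f x - e)]. *)
have [|k] := dense_a x (e := Num.min (r / 2) ((ratr q - (f x - e)) / m%:R)).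
  by rewrite lt_min !divr_gt0// subr_gt0.
rewrite lt_min (ltr_pdivlMr _ _ m0) => /andP[xk1 xk2].
exists (pickle (k, q, m)); rewrite /bump pickleK; split=> [y|]; last first.
  by rewrite lt_max; apply/orP; right; rewrite (sym (a k) x); lra.
(* Inside the ball the linear part is at most [q < f y]; outside it [a k] is farther than [r / 2]
   from [y], so the linear part is at most [0]. *)
rewrite ge_max f0/=; have [yr|yr] := ltP (d x y) r.
  have /ltW := rf _ yr; apply: le_trans.
  by rewrite gerBl mulr_ge0.
apply: le_trans (f0 y); rewrite subr_le0; apply/ltW/(lt_le_trans mq).
rewrite ler_pM2l//; have := tri x (a k) y; lra.
Qed.

(** Growing initial segments of the codes give an increasing sequence of maxima, as monotone
    convergence requires. *)
Definition bump_approx (f : X -> R) (n : nat) : seq nat :=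
  [seq i <- iota 0 n | `[< forall y, bump i y <= f y >]].

Lemma bump_approx_le f n y : (forall z, 0 <= f z) ->
  bump_max (bump_approx f n) y <= f y.
Proof.
move=> f0; rewrite /bump_max /bump_approx big_filter.
by apply: bigmax_le => // i /asboolP.
Qed.

Lemma bump_approx_nondecreasing f y :
  nondecreasing_seq (fun n => bump_max (bump_approx f n) y).
Proof.
move=> m n mn; apply: sub_bigmax_seq => i.
by rewrite !mem_filter !mem_iota => /and3P[-> _ /leq_trans->].
Qed.

(** A bump below [f] that comes within [e] of [f x] stays in the list from some index on. *)
Lemma bump_approx_cvg (f : X -> R) x : continuous f -> (forall y, 0 <= f y) ->
  bump_max (bump_approx f n) x @[n --> \oo] --> f x.
Proof.
move=> cf f0; apply/cvgrPdist_lt => e e0.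
have [i [fi ie]] := bump_sup x cf f0 e0.
exists i.+1 => // n /= ni.
rewrite ger0_norm ?subr_ge0 ?bump_approx_le//.
suff : bump i x <= bump_max (bump_approx f n) x by lra.
apply: (@Order.TotalTheory.bigmax_sup_seq _ _ _ _ 0 i) => //.
by rewrite mem_filter mem_iota/= add0n ni andbT; exact/asboolP.
Qed.

End metric_bumps.

(** * Genericity tested on the bump maxima *)

Section weak_convergence.
Context (R : realType) (X : ptopologicalType) (T : X -> X).
Context (mu : probability (borel X) R) (d : X -> X -> R) (a : nat -> X).
Hypotheses (md : is_metric d) (cd : metric_compatible d).
Hypothesis dense_a : forall x (e : R), 0 < e -> exists i, d x (a i) < e.

Lemma probability_integrable (f : X -> R) :
  continuous f -> bounded_fun f -> mu.-integrable setT (EFin \o f).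
Proof.
have muT : (mu setT < +oo)%E by rewrite probability_setT ltry.
exact: continuous_bounded_integrable.
Qed.

(** Monotone convergence applies; integrability of [f] makes the limit finite, so it passes from
    extended reals to reals. *)
Lemma Rintegral_bump_approx_cvg (f : X -> R) :
  continuous f -> bounded_fun f -> (forall y, 0 <= f y) ->
  \int[mu]_y bump_max d a (bump_approx d a f n) y @[n --> \oo] -->
  \int[mu]_y f y.
Proof.
move=> cf bf f0.
pose g n := bump_max d a (bump_approx d a f n).
have := @cvg_monotone_convergence _ (borel X) R mu setT measurableT
  (fun n y => (g n y)%:E).
have -> : (fun y => limn (fun n => (g n y)%:E)) = EFin \o f.
  apply/funext => y; apply/cvg_lim => //; apply: cvg_EFin; first by near=> n.
  exact: bump_approx_cvg.
move=> H; apply: fine_cvg.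
rewrite /Rintegral fineK; last first.
  exact: integrable_fin_num (probability_integrable cf bf).
apply: H.
- move=> n; apply/measurable_EFinP; apply: continuous_borel_measurable.
  exact: bump_max_continuous.
- by move=> n y _; rewrite lee_fin bump_max_ge0.
- by move=> y _ m n mn; rewrite lee_fin bump_approx_nondecreasing.
Unshelve. all: end_near. Qed.

(** Some bump maximum [g <= f] has integral within [e / 2] of that of [f]; the averages of [g] lie
    below those of [f] and eventually lose less than another [e / 2]. *)
Lemma birkhoff_average_eventually_gt (f : X -> R) x (e : R) :
  (forall s, birkhoff_average T (bump_max d a s) n x @[n --> \oo] -->
     \int[mu]_y bump_max d a s y) ->
  continuous f -> bounded_fun f -> (forall y, 0 <= f y) -> 0 < e ->
  \forall n \near \oo, \int[mu]_y f y - e < birkhoff_average T f n x.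
Proof.
move=> avg cf bf f0 e0; have e20 : 0 < e / 2 by rewrite divr_gt0.
have /cvgrPdist_lt/(_ _ e20)[k _ /(_ k (leqnn k))/=] :=
  Rintegral_bump_approx_cvg cf bf f0.
rewrite ltr_norml => /andP[_ fk].
have /cvgrPdist_lt/(_ _ e20) := avg (bump_approx d a f k).
apply: filterS => n; rewrite ltr_norml => /andP[_ kn].
have := le_birkhoff_average T n x (bump_approx_le d a k ^~ f0).
lra.
Qed.

(** The lower bound for [c + f] bounds the averages of [f] from below, and that for [c - f] bounds
    them from above. *)
Lemma birkhoff_average_cvg (f : X -> R) x :
  (forall s, birkhoff_average T (bump_max d a s) n x @[n --> \oo] -->
     \int[mu]_y bump_max d a s y) ->
  continuous f -> bounded_fun f ->
  birkhoff_average T f n x @[n --> \oo] --> \int[mu]_y f y.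
Proof.
move=> avg cf bf; have [c fc] := (bounded_funP _).1 bf.
have cc : continuous (fun _ : X => c) by move=> y; exact: cvg_cst.
have bc : bounded_fun (fun _ : X => c) by apply/bounded_funP; exists `|c|.
have cD : continuous (fun y => c + f y).
  by move=> y; apply: cvgD; [exact: cvg_cst|exact: cf].
have cB : continuous (fun y => c - f y).
  by move=> y; apply: cvgB; [exact: cvg_cst|exact: cf].
have bD : bounded_fun (fun y => c + f y) by exact: bounded_funD.
have bB : bounded_fun (fun y => c - f y).
  by apply: bounded_funD => //; exact: bounded_funN.
have D0 y : 0 <= c + f y by have := fc y; rewrite ler_norml; lra.
have B0 y : 0 <= c - f y by have := fc y; rewrite ler_norml; lra.
apply/cvgrPdist_lt => e e0.
have := birkhoff_average_eventually_gt avg cD bD D0 e0.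
have := birkhoff_average_eventually_gt avg cB bB B0 e0.
rewrite RintegralB ?RintegralD//; try exact: probability_integrable.
(* At [n = 0] the average of the constant [c] would be [0] instead of [c]. *)
apply: filterS3 (nbhs_infty_gt 0) => n n0.
rewrite birkhoff_averageB birkhoff_averageD birkhoff_average_cst// ltr_norml.
rewrite Rintegral_cst// (_ : fine _ = 1) ?mulr1; last first.
  exact: (congr1 fine (probability_setT mu)).
lra.
Qed.

(** Lists are coded by natural numbers; a number that codes no list stands for the empty list, which
    is already among the tests. *)
Lemma generic_pointsE : generic_points T mu =
  \bigcap_i [set x | birkhoff_average T
     (bump_max d a (odflt [::] (@unpickle (seq nat) i))) n x @[n --> \oo] -->
     \int[mu]_y bump_max d a (odflt [::] (@unpickle (seq nat) i)) y].
Proof.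
have intE (f : X -> R) x : continuous f -> bounded_fun f ->
    (fun n => \int[empirical_measure R T x n]_y f y) =
    (fun n => birkhoff_average T f n x).
  by move=> cf bf; apply/funext => n; exact: Rintegral_empirical.
apply/seteqP; split=> x.
  move=> gx i _ /=; rewrite -intE.
  - by apply: gx; [exact: bump_max_continuous|exact: bump_max_bounded].
  - exact: bump_max_continuous.
  - exact: bump_max_bounded.
move=> avg f cf bf; rewrite intE//; apply: birkhoff_average_cvg => // s.
by have := avg (pickle s) I; rewrite /mkset pickleK.
Qed.

End weak_convergence.

Theorem fact13 (R : realType) (X : ptopologicalType) (T : X -> X)
    (mu : probability (borel X) R) :
  polish_space R X -> continuous T ->
  invariant_measures T mu ->
  Pi03 (generic_points T mu).
Proof.
move=> [[D cD dD] [d [md cd _]]] cT _.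
(* All that matters about [a] is that every point of [D] is one of its values: each ball is open and
   nonempty, so it meets [D]. *)
have /pcard_surjP[a aD] : (D #<= [set: nat])%card by [].
have dense_a x (e : R) : 0 < e -> exists i, d x (a i) < e.
  move=> e0; have [|y [/= xy /aD[i _ iy]]] := dD [set y | d x y < e] _
    (metric_ball_open md cd x e).
    by exists x; exact: metric_ball_center.
  by exists i; rewrite iy.
rewrite (generic_pointsE T mu md cd dense_a).
apply: bigcap_Pi03 => i; apply: cvg_Pi03 => n.
apply: birkhoff_average_continuous => //.
exact: bump_max_continuous.
Qed.
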